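(* Let $p$ be a prime, $q=p^d$, $m\ge 1$, $H$ a subgroup of $GL_m\mathbb{F}_q$, $n\ge 1$, $x\in\mathbb{C}$, and let $\lambda$ be a partition of $n$. Let $\rho_\lambda$ be the complex Specht representation of $\Sigma_n$ attached to $\lambda$, and regard $\Sigma_n$ as the subgroup $\{(\sigma,1,\dots,1)\}$ of the wreath product $\Sigma_n\wr H$. Then \[ W^{x,H}_{n,\Sigma_n\wr H}\big(\mathrm{Ind}_{\Sigma_n}^{\Sigma_n\wr H}(\rho_\lambda)\big)=f_\lambda\big(x\,e^{2\pi\sqrt{-1}\,md/p}\big), \] where $f_\lambda(y)=\prod_{(i,j)\in[\lambda]}(y-i+j)$.
   Context: The diagram of a partition $\lambda=(\lambda_1\ge\dots\ge\lambda_r>0)$ is $[\lambda]=\{(i,j): 1\le i\le r,\ 1\le j\le\lambda_i\}$; $\rho_\lambda$ is the irreducible complex representation $S^\lambda\otimes_{\mathbb{Q}}\mathbb{C}$ of $\Sigma_n$ given by the Specht module. The wreath product $\Sigma_n\wr H$ has elements $(\sigma,\alpha_1,\dots,\alpha_n)$ with $\sigma\in\Sigma_n$, $\alpha_i\in H$, and product $(\sigma,\alpha_1,\dots,\alpha_n)(\sigma',\alpha'_1,\dots,\alpha'_n)=(\sigma\sigma',\alpha_1\alpha'_{\sigma(1)},\dots,\alpha_n\alpha'_{\sigma(n)})$, where permutations are composed so that $(\sigma\sigma')(i)=\sigma'(\sigma(i))$. For $\sigma\in\Sigma_n$ let $l(\sigma)$ be the number of cycles of $\sigma$ (fixed points counted)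 and $\psi_{n,x}(\sigma)=x^{l(\sigma)}$. For $X=(\sigma,\alpha_1,\dots,\alpha_n)$ define \[ \Lambda_{n,x,H}(X)=\prod_{\text{cycles }(x_1,\dots,x_r)\text{ of }\sigma} e^{2\pi\sqrt{-1}\,\mathrm{Tr}_{\mathbb{F}_q/\mathbb{F}_p}(\mathrm{Trace}(\alpha_{x_1}\alpha_{x_2}\cdots\alpha_{x_r}))/p}, \] the product over the cycles of $\sigma$ (including 1-cycles), each written with $\sigma(x_s)=x_{s+1}$; here $\mathrm{Trace}$ is the matrix trace on $GL_m\mathbb{F}_q$ and $\mathrm{Tr}_{\mathbb{F}_q/\mathbb{F}_p}$ the field trace. For a subgroup $J\subseteq\Sigma_n\wr H$ and a finite-dimensional complex representation $\rho$ of $J$ with character $\chi_\rho$, define \[ W^{x,H}_{n,J}(\rho)=\frac{1}{\dim_{\mathbb{C}}\rho}\sum_{X=(\sigma,\alpha_1,\dots,\alpha_n)\in J}\chi_\rho(X)\,\psi_{n,x}(\sigma)\,\Lambda_{n,x,H}(X). \] *)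

(* Defs.v *)
From HB Require Import structures.
From mathcomp Require Import all_boot all_order all_algebra all_fingroup all_field.
Set Implicit Arguments. Unset Strict Implicit. Unset Printing Implicit Defensive.
Import Order.TTheory GRing.Theory Num.Theory.
Local Open Scope ring_scope.

Definition is_partition (n : nat) (lam : seq nat) : bool :=
  [&& sorted geq lam, all (fun k => 0 < k)%N lam & sumn lam == n].

(* cells of [lam] enumerated in row-major order by k = 0 .. n-1;
   (0-based) row and column of the k-th cell *)
Definition rowof (lam : seq nat) (k : nat) : nat :=
  count (fun i => sumn (take i.+1 lam) <= k)%N (iota 0 (size lam)).
Definition colof (lam : seq nat) (k : nat) : nat :=
  (k - sumn (take (rowof lam k) lam))%N.

Definition flam (C : numClosedFieldType) (lam : seq nat) (y : C) : C :=
  \prod_(i < size lam) \prod_(j < nth 0%N lam i) (y - (i.+1)%:R + (j.+1)%:R).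

Section Specht.
Variables (C : numClosedFieldType) (n : nat) (lam : seq nat).

(* tabloids: functions entry -> row index *)
Definition tabloid := {ffun 'I_n -> 'I_n.+1}.

(* a tableau tau : entry tau(k) sits in the k-th cell of [lam];
   its tabloid {t} sends an entry to its row *)
Definition tab_of (tau : {perm 'I_n}) : tabloid :=
  [ffun j => inord (rowof lam (tau^-1 j)%g)].

Definition colstab (tau pi : {perm 'I_n}) : bool :=
  [forall j, colof lam (tau^-1 (pi j))%g == colof lam (tau^-1 j)%g].

Definition tabvec (f : tabloid) : 'rV[C]_#|{: tabloid}| :=
  delta_mx 0 (enum_rank f).

(* polytabloid e_t = sum_{pi in C_t} sgn(pi) pi{t};
   the tableau pi t is tau * pi (entry pi(tau k) in cell k) *)
Definition polytab (tau : {perm 'I_n}) : 'rV[C]_#|{: tabloid}| :=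
  \sum_(pi : {perm 'I_n} | colstab tau pi) ((-1) ^+ pi) *: tabvec (tab_of (tau * pi)%g).

Definition specht_mx : 'M[C]_(#|{: {perm 'I_n}}|, #|{: tabloid}|) :=
  \matrix_(i < #|{: {perm 'I_n}}|) polytab (enum_val i).

Definition tab_act (sigma : {perm 'I_n}) (f : tabloid) : tabloid :=
  [ffun j => f (sigma^-1 j)%g].

Definition perm_mod_mx (sigma : {perm 'I_n}) : 'M[C]_#|{: tabloid}| :=
  \matrix_(a, b) ((enum_val b == tab_act sigma (enum_val a)) : nat)%:R.

(* character of rho_lam: trace of sigma restricted to S^lam (x) C,
   computed in the basis row_base specht_mx *)
Definition specht_char (sigma : {perm 'I_n}) : C :=
  let B := row_base specht_mx in \tr (B *m perm_mod_mx sigma *m pinvmx B).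

End Specht.

Section Wreath.
Variables (n m : nat) (F : finFieldType).

Definition wr := ({perm 'I_n} * {ffun 'I_n -> {'GL_m[F]}})%type.

Definition in_wr (H : {set {'GL_m[F]}}) (X : wr) : bool := [forall i, X.2 i \in H].

(* (s,a)(s',a') = (s s', a_i a'_{s(i)}), with (s s')(i) = s'(s(i)),
   which is MathComp's composition of permutations *)
Definition wmul (X Y : wr) : wr :=
  ((X.1 * Y.1)%g, [ffun i => (X.2 i * Y.2 (X.1 i))%g]).
Definition winv (X : wr) : wr :=
  ((X.1^-1)%g, [ffun i => ((X.2 ((X.1^-1)%g i))^-1)%g]).

Definition in_Sigma (X : wr) : bool := [forall i, X.2 i == 1%g].

Definition ind_char (C : numClosedFieldType) (H : {set {'GL_m[F]}})
    (chi : {perm 'I_n} -> C) (X : wr) : C :=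
  (n`!%:R)^-1 * \sum_(Y : wr | in_wr H Y)
     (let Z := wmul (wmul Y X) (winv Y) in if in_Sigma Z then chi Z.1 else 0).

End Wreath.

Section Weight.
Variables (C : numClosedFieldType) (p d : nat) (F : finFieldType).

(* zeta = exp(2 pi i / p): the square of the p-th root of -1 with
   minimal nonnegative argument (= exp(pi i / p)) *)
Definition zetap : C := (p.-root (-1)) ^+ 2.

Definition trFp (a : F) : F := \sum_(i < d) a ^+ (p ^ i).

Definition trexp (a : F) : nat := oapp val 0%N [pick k : 'I_p | (k%:R : F) == trFp a].

Definition echar (a : F) : C := zetap ^+ trexp a.

Variables (n m : nat).

Definition Lambda (X : wr n m F) : C :=
  \prod_(A in porbits X.1)
    oapp (fun x0 => echar (\tr (\prod_(k < #|A|) GLval (X.2 ((X.1 ^+ k)%g x0)))))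
         1 [pick x0 in A].

Definition psi (x : C) (sigma : {perm 'I_n}) : C := x ^+ #|porbits sigma|.

(* W^{x,H}_{n,Sigma_n wr H} of a representation given by its character chi;
   dim rho = chi(1) *)
Definition W_wr (x : C) (H : {set {'GL_m[F]}}) (chi : wr n m F -> C) : C :=
  (chi (1%g, [ffun=> 1%g]))^-1 *
  \sum_(X : wr n m F | in_wr H X) chi X * psi x X.1 * Lambda X.

End Weight.

(* Main.v *)
Require Import Defs.
From HB Require Import structures.
From mathcomp Require Import all_boot all_order all_algebra all_fingroup all_field.
From mathcomp Require Import zify ring.
Import GRing.Theory Num.Theory.
Set Implicit Arguments. Unset Strict Implicit. Unset Printing Implicit Defensive.

(** The elements of [Sigma_n wr H] conjugate into [Sigma_n] have trivial cycle
    products, so [Lambda] takes on them the value [zeta^(m d l(s))], and the sum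
    defining [W] collapses to [sum_s chi(s) y^l(s)] with [y = x zeta^(m d)].  By Jucys,
    [sum_s y^l(s) s = prod_k (y + J_k)], where [J_k] is the sum of the
    transpositions [(i k)] with [i] before [k] in a fixed total order of the
    entries.  Order them column by column: for the initial tableau, whose k-th
    entry is k, the entries before [k] are those of the full columns on its
    left and those above it.  A Garnir relation makes each such column act on
    the polytabloid as [1], and each entry above [k] acts as [-1], so [J_k] acts
    as the content of the cell [k].  The central element [sum_s y^l(s) s]
    therefore acts on the whole Specht module, which this polytabloid
    generates, as the product of the [y + content]. *)

(** * Cells of a partition *)

(** Peeling off the first row turns the counting definition into a recursion, which drives the
    inductions on [lam] below. *)
Lemma rowof_cons a lam k :
  rowof (a :: lam) k = if k < a then 0 else (rowof lam (k - a)).+1.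
Proof.
rewrite /rowof /= take0 /= addn0 leqNgt -[1]addn0 iotaDl count_map.
case: ltnP => [lt_ka | le_ak] /=.
  apply/eqP; rewrite -leqn0 leqNgt -has_count; apply/hasPn => i _ /=.
  by rewrite -ltnNge (leq_trans lt_ka) ?leq_addr.
by rewrite add1n; congr _.+1; apply: eq_count => i /=; rewrite leq_subRL.
Qed.

Lemma colof_cons a lam k :
  colof (a :: lam) k = if k < a then k else colof lam (k - a).
Proof.
by rewrite /colof rowof_cons; case: ltnP => //= le_ak; rewrite ?subn0 ?subnDA.
Qed.

Lemma cell_bounds lam k : k < sumn lam ->
  [/\ rowof lam k < size lam, colof lam k < nth 0 lam (rowof lam k)
    & sumn (take (rowof lam k) lam) + colof lam k = k].
Proof.
elim: lam k => //= a lam IH k lt_k.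
rewrite rowof_cons colof_cons; case: (ltnP k a) => [|le_ak] /=; first by [].
have [|r1 r2 r3] := IH (k - a); first by lia.
by split=> //; lia.
Qed.

Lemma cell_exists lam i j : i < size lam -> j < nth 0 lam i ->
  exists k, [/\ k < sumn lam, rowof lam k = i & colof lam k = j].
Proof.
elim: lam i => //= a lam IH [|i] /= lt_i lt_j.
  by exists j; rewrite rowof_cons colof_cons lt_j; split=> //; lia.
have [k [k1 k2 k3]] := IH i lt_i lt_j.
exists (a + k); rewrite rowof_cons colof_cons (ltnNge _ a) leq_addr addKn k2 k3.
by split=> //; lia.
Qed.

Lemma prod_cells (R : comNzRingType) lam (f : nat -> nat -> R) :
  (\prod_(k < sumn lam) f (rowof lam k) (colof lam k) =
   \prod_(i < size lam) \prod_(j < nth 0 lam i) f i j)%R.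
Proof.
elim: lam f => [|a lam IH] f /=; first by rewrite !big_ord0.
rewrite big_split_ord big_ord_recl /=; congr (_ * _)%R.
  by apply: eq_bigr => i _; rewrite rowof_cons colof_cons ltn_ord.
rewrite -(IH (fun i j => f i.+1 j)); apply: eq_bigr => i _.
by rewrite rowof_cons colof_cons ltnNge leq_addr /= addKn.
Qed.

Section Cells.
Context {n : nat} {lam : seq nat}.
Hypothesis lam_part : is_partition n lam.
Implicit Types i k : 'I_n.

Let sum_lam : sumn lam = n. Proof. by case/and3P: lam_part => _ _ /eqP. Qed.
Let cell_bounds_ord k : [/\ rowof lam k < size lam, colof lam k < nth 0 lam (rowof lam k)
    & sumn (take (rowof lam k) lam) + colof lam k = k].
Proof. by apply: cell_bounds; rewrite sum_lam. Qed.

Lemma cell_ord (i j : nat) : i < size lam -> j < nth 0 lam i ->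
  exists2 k : 'I_n, rowof lam k = i & colof lam k = j.
Proof.
move=> lt_i lt_j; have [k [k1 k2 k3]] := cell_exists lt_i lt_j.
by rewrite sum_lam in k1; exists (Ordinal k1).
Qed.

(** Positive parts bound the number of rows by [n]. Hence [inord] in [tab_of] loses nothing, and
    [n.+1] can serve as the radix of the column-first key. *)
Lemma rowof_lt k : rowof lam k < n.+1.
Proof.
have [lt_r _ _] := cell_bounds_ord k; rewrite ltnS -[X in _ <= X]sum_lam.
apply: leq_trans (ltnW lt_r) _.
case/and3P: lam_part => _ + _; elim: (lam) => //= a s IH /andP[a_gt0 /IH].
lia.
Qed.

Lemma cell_inj i k : rowof lam i = rowof lam k -> colof lam i = colof lam k -> i = k.
Proof.
move=> eq_r eq_c; apply: val_inj => /=.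
have [_ _ <-] := cell_bounds_ord i; have [_ _ <-] := cell_bounds_ord k.
by rewrite eq_r eq_c.
Qed.

Lemma left_cell k j : j < colof lam k ->
  exists2 c : 'I_n, rowof lam c = rowof lam k & colof lam c = j.
Proof.
have [lt_r lt_c _] := cell_bounds_ord k => lt_j.
exact: cell_ord lt_r (ltn_trans lt_j lt_c).
Qed.

(** Parts decrease weakly, so every higher row is long enough to reach the column of [k]. *)
Lemma up_cell k r : r < rowof lam k ->
  exists2 c : 'I_n, rowof lam c = r & colof lam c = colof lam k.
Proof.
have [lt_r lt_c _] := cell_bounds_ord k => lt_rk.
apply: cell_ord; [exact: ltn_trans lt_rk lt_r | apply: leq_trans lt_c _].
case/andP: lam_part => lam_sorted _.
have := sorted_leq_nth (rev_trans leq_trans) leqnn 0 lam_sorted.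
by move/(_ _ _ (ltn_trans lt_rk lt_r) lt_r (ltnW lt_rk)).
Qed.

(** [rowof] maps the cells above [k] bijectively onto the row indices smaller than that of [k]. This
    count is the negative part of the content. *)
Lemma card_above k :
  #|[set i : 'I_n | (colof lam i == colof lam k) && (rowof lam i < rowof lam k)]| = rowof lam k.
Proof.
set S := [set i | _]; rewrite -[RHS](size_iota 0) -(size_image (rowof lam \o val) S).
apply: perm_size; apply: uniq_perm; rewrite ?iota_uniq //.
  rewrite map_inj_in_uniq ?enum_uniq // => i j.
  rewrite !mem_enum !inE => /andP[/eqP ci _] /andP[/eqP cj _] rij.
  by apply: cell_inj; rewrite // ci cj.
move=> r; rewrite mem_iota; apply/imageP/idP => [[i]|].
  by rewrite inE => /andP[_ lt_i] ->.
rewrite add0n => lt_r; have [c rc cc] := up_cell lt_r.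
by exists c; rewrite ?inE ?cc ?eqxx /= rc.
Qed.

End Cells.

Local Open Scope ring_scope.

(** * Cycles and Jucys-Murphy elements *)

Section PermCycles.
Context {T : finType}.
Implicit Types (S : {set T}) (s t : {perm T}) (i k : T).

Lemma perm_on_setU1_fix S k s : k \notin S ->
  (perm_on (k |: S) s && (s k == k)) = perm_on S s.
Proof.
move=> kS; apply/andP/idP => [[/subsetP on_kS /eqP sk] | on_S].
  apply/subsetP => i si; have := on_kS i si; rewrite !inE => /orP[/eqP ik|//].
  by move: si; rewrite !inE ik sk eqxx.
split; last by rewrite (out_perm on_S).
exact: subset_trans on_S (subsetUr _ _).
Qed.

(** A permutation [s] supported on [k |: S] factors uniquely as [tperm i k * t] with [t] supported
    on [S]: take [i] to be the preimage of [k] under [s]. The case [i = k] gives [t] itself. *)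
Lemma sum_perm_on_setU1 (V : nmodType) S k (f : {perm T} -> V) : k \notin S ->
  \sum_(s | perm_on (k |: S) s) f s =
  \sum_(t | perm_on S t) (f t + \sum_(i in S) f (tperm i k * t)%g).
Proof.
move=> kS; rewrite (partition_big (fun s : {perm T} => (s^-1)%g k) [in k |: S]) /=; last first.
  by move=> s on_s; rewrite (perm_closed k (perm_onV on_s)) !inE eqxx.
rewrite (eq_bigr (fun i => \sum_(t | perm_on S t) f (tperm i k * t)%g)); last first.
  move=> i iS; rewrite (reindex_inj (mulgI (tperm i k))) /=; apply: eq_bigl => t.
  rewrite -(perm_on_setU1_fix _ kS) invMg permM tpermV.
  have on_t : perm_on (k |: S) (tperm i k).
    apply: subset_trans (tperm_on i k) _; apply/subsetP => j.
    by rewrite !inE => /orP[]/eqP->; rewrite ?eqxx //; rewrite !inE in iS.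
  congr (_ && _).
    apply/idP/idP => [/(perm_onM on_t)|]; last exact: perm_onM.
    by rewrite mulgA tperm2 mul1g.
  rewrite -{2}(tpermR i k) (inj_eq perm_inj) -(inj_eq (@perm_inj _ t)) permKV.
  by rewrite eq_sym.
rewrite exchange_big /=; apply: eq_bigr => t _.
by rewrite big_setU1 //= tperm1 mul1g.
Qed.

(** Each point outside [S] is an orbit by itself. This keeps the subtraction in the exponent of the
    Jucys induction from truncating. *)
Lemma porbits_perm_on S s : perm_on S s -> (#|T| - #|S| <= #|porbits s|)%N.
Proof.
move=> on_s; rewrite -[S]setCK -cardsCs -(card_imset _ (@set1_inj T)) subset_leq_card //.
apply/subsetP=> _ /imsetP[i + ->]; rewrite inE => iS.
apply/imsetP; exists i => //; apply/setP => j; rewrite inE.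
apply/eqP/porbitP => [->|[a ->]]; first by exists 0%N; rewrite perm1.
elim: a => [|a IH]; first by rewrite perm1.
by rewrite expgSr permM IH (out_perm on_s).
Qed.

(** As [s] fixes [k], the transposition merges the cycle [{k}] into the cycle of [i]. *)
Lemma porbits_tperm_mul S s i k : perm_on S s -> k \notin S -> i != k ->
  #|porbits s| = #|porbits (tperm i k * s)%g|.+1.
Proof.
move=> on_s kS neq_ik; have := porbits_mul_tperm s i k; rewrite neq_ik /=.
have -> : i \notin porbit s k; last by rewrite /=; lia.
apply: contra neq_ik => /porbitP[a ->]; elim: a => [|a IH]; first by rewrite perm1.
by rewrite expgSr permM (eqP IH) (out_perm on_s).
Qed.

Lemma porbits_conj s t : #|porbits (s ^ t)%g| = #|porbits s|.
Proof.
have porbitJ x : porbit (s ^ t)%g (t x) = t @: porbit s x.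
  apply/setP => z; apply/porbitP/imsetP => [[a ->] | [w /porbitP[a ->] ->]].
    by exists ((s ^+ a)%g x); rewrite ?mem_porbit // -conjXg conjgE !permM permK.
  by exists a; rewrite -conjXg conjgE !permM permK.
rewrite -[RHS](card_imset _ (imset_inj (@perm_inj _ t))); congr #|pred_of_set _|.
apply/setP => A; apply/idP/imsetP => [/imsetP[x _ ->] | [_ /imsetP[x _ ->] ->]].
  by exists (porbit s ((t^-1)%g x)); rewrite ?imset_f // -porbitJ permKV.
by rewrite -porbitJ imset_f.
Qed.

End PermCycles.

(* Jucys: sum_s y^(cycles of s) s = prod_k (y + J_k) in the group algebra,
   [J_k] being the sum of the transpositions (i k) with i before k. *)
Lemma jucys_eigen (R : comPzRingType) (T : finType) (N : nat)
    (rho : {perm T} -> 'M[R]_N) (key : T -> nat) (v : 'rV[R]_N) (c : T -> R) (y : R) :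
  rho 1%g = 1%:M -> {morph rho : s t / (s * t)%g >-> s *m t} -> injective key ->
  (forall k, \sum_(i | (key i < key k)%N) v *m rho (tperm i k) = c k *: v) ->
  \sum_s y ^+ #|porbits s| *: (v *m rho s) = (\prod_k (y + c k)) *: v.
Proof.
move=> rho1 rhoM key_inj Jv.
pose S a := [set i | (key i < a)%N].
(* Induction on an initial segment of the order; the exponent discounts the fixed points outside
   [S a], so that it counts cycles within [S a] only. *)
suff sumS a : \sum_(s | perm_on (S a) s)
    y ^+ (#|porbits s| - (#|T| - #|S a|)) *: (v *m rho s) = (\prod_(k in S a) (y + c k)) *: v.
  have ST : S (\max_i key i).+1 = setT.
    by apply/setP => i; rewrite !inE ltnS leq_bigmax.
  have := sumS (\max_i key i).+1; rewrite ST cardsT subnn => sumT.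
  rewrite (eq_bigl (in_mem^~ (mem [set: T]))) => [|i]; last by rewrite !inE.
  rewrite -sumT; apply: eq_big => [s|s _]; last by rewrite subn0.
  by apply/esym/subsetP => i _; rewrite inE.
elim: a => [|a IH].
  have -> : S 0 = set0 by apply/setP => i; rewrite !inE.
  rewrite big_set0 scale1r (big_pred1 1%g) => [|s]; last first.
    apply/idP/eqP => [on_s|->]; last exact: perm_on1.
    by apply/permP => i; rewrite perm1 (out_perm on_s) ?inE.
  have /eqP e0 : (#|porbits (1%g : {perm T})| - #|T| == 0)%N.
    by rewrite subn_eq0 leq_imset_card.
  by rewrite rho1 mulmx1 cards0 subn0 e0 scale1r.
have [/existsP[k /eqP key_k] | /existsPn no_k] := boolP [exists k, key k == a]; last first.
  suff -> : S a.+1 = S a by [].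
  by apply/setP => i; rewrite !inE ltnS leq_eqVlt (negPf (no_k i)).
have SS : S a.+1 = k |: S a.
  by apply/setP => i; rewrite !inE ltnS leq_eqVlt -{1}key_k (inj_eq key_inj).
have kS : k \notin S a by rewrite inE key_k ltnn.
rewrite SS sum_perm_on_setU1 // big_setU1 //= -scalerA -IH scaler_sumr.
apply: eq_bigr => t on_t; rewrite cardsU1 kS add1n.
have leS : (#|S a| < #|T|)%N.
  by rewrite -cardsT proper_card // properT; apply: contraNneq kS => ->; rewrite inE.
have le_t := porbits_perm_on on_t.
(* With [k] fixed there is one more cycle, hence [y ^+ e.+1]; with [k] merged the exponent stays
   [e]. The transposition stands on the left, so it meets the row vector [v] first and [Jv]
   applies. *)
set e := (_ - (_ - #|S a|))%N.
have -> : (#|porbits t| - (#|T| - #|S a|.+1) = e.+1)%N by rewrite /e; lia.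
rewrite (eq_bigr (fun i => y ^+ e *: ((v *m rho (tperm i k)) *m rho t))); last first.
  move=> i iS; have neq_ik : i != k by apply: contraNneq kS => <-.
  have := porbits_tperm_mul on_t kS neq_ik => eq_t.
  rewrite rhoM mulmxA; congr (_ ^+ _ *: _); by rewrite /e eq_t subnS -subSS prednK ?subn_gt0.
rewrite -scaler_sumr -mulmx_suml.
rewrite (eq_bigl (fun i => key i < key k)%N) => [|i]; last by rewrite inE key_k.
by rewrite Jv -scalemxAl !scalerA -scalerDl exprSr -mulrDr mulrC.
Qed.

(** * The Specht module *)

Section SpechtModule.
Context {C : numClosedFieldType} {n : nat} {lam : seq nat}.
Hypothesis lam_part : is_partition n lam.
Implicit Types (s t tau pi : {perm 'I_n}) (i j k u v : 'I_n).

Lemma tab_act_of s tau : tab_act s (tab_of lam tau) = tab_of lam (tau * s)%g.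
Proof. by apply/ffunP => j; rewrite !ffunE invMg permM. Qed.

Lemma perm_mod_mxE (f g : tabloid n) s :
  perm_mod_mx C s (enum_rank f) (enum_rank g) = (g == tab_act s f)%:R.
Proof. by rewrite mxE !enum_rankK. Qed.

Lemma tabvec_act (f : tabloid n) s :
  tabvec C f *m perm_mod_mx C s = tabvec C (tab_act s f).
Proof.
rewrite /tabvec -rowE; apply/rowP => b; rewrite -(enum_valK b) mxE perm_mod_mxE mxE eqxx /=.
by rewrite (inj_eq enum_rank_inj).
Qed.

(** Conjugation by [s] carries the column stabilizer of [tau] to that of [tau * s] and preserves
    signs. *)
Lemma polytab_act tau s :
  polytab C lam tau *m perm_mod_mx C s = polytab C lam (tau * s)%g.
Proof.
rewrite /polytab mulmx_suml [RHS](reindex_inj (conjg_inj s)) /=.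
apply: eq_big => [pi | pi _].
  apply/forallP/forallP => col_pi j.
    have := col_pi ((s^-1)%g j).
    by rewrite conjgE invMg !permM permK.
  have := col_pi (s j).
  by rewrite conjgE invMg !permM !permK.
rewrite -scalemxAl tabvec_act tab_act_of odd_permJ.
by rewrite -!mulgA [(pi * s)%g]conjgC.
Qed.

Lemma perm_mod_mx1 : perm_mod_mx C (1%g : {perm 'I_n}) = 1%:M.
Proof.
apply/matrixP => a b; rewrite !mxE -(inj_eq enum_val_inj) eq_sym; congr (_ == _)%:R.
by apply/ffunP => j; rewrite ffunE invg1 perm1.
Qed.

Lemma perm_mod_mxM :
  {morph (@perm_mod_mx C n) : s t / (s * t)%g >-> s *m t}.
Proof.
move=> s t; apply/row_matrixP => a; rewrite row_mul !rowE -(enum_valK a).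
rewrite -!/(tabvec C _) !tabvec_act; congr tabvec.
by apply/ffunP => j; rewrite !ffunE invMg permM.
Qed.

Definition tvec tau := tabvec C (tab_of lam tau).
Local Notation e1 := (polytab C lam (1%g : {perm 'I_n})).
Local Notation col := (colof lam).
Local Notation row := (rowof lam).

Lemma eq_tvec s t : (forall j, row (s^-1 j)%g = row (t^-1 j)%g) -> tvec s = tvec t.
Proof.
by move=> eq_st; congr tabvec; apply/ffunP => j; rewrite !ffunE eq_st.
Qed.

Lemma colstab1P pi : reflect (forall j, col (pi j) = col j) (colstab lam 1 pi).
Proof.
apply: (iffP forallP) => col_pi j; have := col_pi j; rewrite invg1 !perm1.
  by move/eqP.
by move->.
Qed.

Lemma polytab1_act s :
  e1 *m perm_mod_mx C s = \sum_(pi | colstab lam 1 pi) (-1) ^+ pi *: tvec (pi * s)%g.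
Proof.
rewrite mulmx_suml; apply: eq_bigr => pi _.
by rewrite -scalemxAl tabvec_act tab_act_of mul1g.
Qed.

Lemma polytab1E : e1 = \sum_(pi | colstab lam 1 pi) (-1) ^+ pi *: tvec pi.
Proof. by apply: eq_bigr => pi _; rewrite mul1g. Qed.

Lemma polytab1_col i k : i != k -> col i = col k ->
  e1 *m perm_mod_mx C (tperm i k) = - e1.
Proof.
move=> neq_ik eq_col; rewrite polytab1_act polytab1E -sumrN.
rewrite [RHS](reindex_inj (mulIg (tperm i k))) /=; apply: eq_big => [pi | pi _]; last first.
  by rewrite odd_permM odd_tperm neq_ik signr_addb mulrN1 scaleNr opprK.
have col_t j : col (tperm i k j) = col j by case: tpermP => // ->.
by apply/colstab1P/colstab1P => col_pi j; have := col_pi j; rewrite permM col_t.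
Qed.

(* The Garnir relation exchanging one cell [k] with a full column [c] on its
   left.  In the tabloid of [pi] the row of [k] meets column [c] at the entry
   [a pi]; exchanging [k] with [a pi] fixes the tabloid, and the remaining
   terms cancel under the involution (pi, i) |-> (pi (i a), a). *)
Lemma polytab1_garnir (c : nat) k : (c < col k)%N ->
  \sum_(i : 'I_n | col i == c) e1 *m perm_mod_mx C (tperm i k) = e1.
Proof.
move=> lt_ck.
(* The cell of column [c] in the row of [u]. It exists whenever [c < col u], the only case in which
   [L] is evaluated through [LP]. *)
pose L (u : 'I_n) := odflt u [pick v : 'I_n | (row v == row u) && (col v == c)].
have LP (u : 'I_n) : (c < col u)%N -> row (L u) = row u /\ col (L u) = c.
  rewrite /L => /(left_cell lam_part)[v rv cv].
  case: pickP => [w /andP[/eqP-> /eqP->] //|/(_ v)].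
  by rewrite rv cv !eqxx.
have col_inv pi j : colstab lam 1 pi -> col (pi^-1 j)%g = col j.
  by move/colstab1P => col_pi; rewrite -[in RHS](permKV pi j) col_pi.
pose a pi := pi (L (pi^-1 k)%g).
have aP pi : colstab lam 1 pi -> row (pi^-1 (a pi))%g = row (pi^-1 k)%g /\ col (a pi) = c.
  move=> col_pi; have [|r1 r2] := LP (pi^-1 k)%g; first by rewrite col_inv.
  by rewrite /a permK; split=> //; move/colstab1P: col_pi => ->.
have neq_k i : col i = c -> i != k.
  by move=> ci; apply: contraTneq lt_ck => <-; rewrite ci ltnn.
pose G pi i : 'rV[C]_#|{: tabloid n}| := (-1) ^+ pi *: tvec (pi * tperm i k)%g.
pose P (p : {perm 'I_n} * 'I_n) := colstab lam 1 p.1 && ((col p.2 == c) && (p.2 != a p.1)).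
pose h (p : {perm 'I_n} * 'I_n) := ((p.1 * tperm p.2 (a p.1))%g, a p.1).
have hP p : P p -> P (h p) /\ h (h p) = p.
  case: p => pi i /and3P[/= col_pi /eqP ci neq_ia]; have [ra ca] := aP pi col_pi.
  have a_h : a (pi * tperm i (a pi))%g = i.
    rewrite /a invMg !permM tpermV [tperm i _ k]tpermD ?neq_k // -/(a pi).
    by rewrite tpermR.
  rewrite /P /h /= a_h ca eqxx eq_sym neq_ia !andbT; split.
    apply/colstab1P => j; move/colstab1P: col_pi => col_pi; rewrite permM -(col_pi j).
    by case: tpermP => [->|->|//]; rewrite ca ci.
  by rewrite tpermC -mulgA tperm2 mulg1.
have GhN p : P p -> G (h p).1 (h p).2 = - G p.1 p.2.
  case: p => pi i /and3P[/= col_pi /eqP ci neq_ia]; have [ra ca] := aP pi col_pi.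
  rewrite /G odd_permM odd_tperm neq_ia signr_addb mulrN1 scaleNr; congr (- (_ *: _)).
  (* The two tableaux differ only by exchanging the entries [i] and [a pi], which occupy one row by
     [ra]. *)
  apply: eq_tvec => j; rewrite !invMg !permM !tpermV.
  have [->|neq_jk] := eqVneq j k.
    by rewrite !tpermR.
  have [->|neq_ja] := eqVneq j (a pi).
    by rewrite tpermL tpermD ?neq_k // [tperm i k _]tpermD // eq_sym neq_k.
  rewrite [tperm (a pi) k j]tpermD; do ?by rewrite eq_sym.
  have [->|neq_ji] := eqVneq j i; first by rewrite !tpermL.
  by rewrite !tpermD // eq_sym.
have sumG0 : \sum_(p | P p) G p.1 p.2 = 0.
  set X := (LHS); suff XN : X = - X.
    have : 2%:R *: X = 0 by rewrite scaler_nat mulr2n {1}XN addNr.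
    by move/eqP; rewrite scaler_eq0 pnatr_eq0 => /eqP.
  rewrite {1}/X (reindex_onto h h) /=; last by move=> p /hP[].
  rewrite -sumrN; apply: eq_big => [p | p /andP[/hP[Php _] /eqP <-]].
    apply/andP/idP => [[/hP[Php _] /eqP <-] // | /hP[Pp ->]].
    by rewrite eqxx.
  by rewrite GhN //; case: (hP _ Php) => _ ->.
under eq_bigr do rewrite polytab1_act.
rewrite -(pair_big_dep (colstab lam 1)
  (fun pi i => (col i == c) && (i != a pi)) G) /= in sumG0.
(* Once the vanishing sum is added on the right, both sides agree for each [pi]: the index [a pi]
   yields [tvec pi], the others yield the vanishing part. *)
rewrite exchange_big /= polytab1E -[RHS]addr0.
set rest := (X in _ = _ + X); rewrite -[rest]sumG0 {}/rest -big_split /=.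
apply: eq_bigr => pi col_pi; have [ra ca] := aP pi col_pi.
rewrite (bigD1 (a pi)) ?ca //=; congr (_ *: _ + _).
apply: eq_tvec => j; rewrite invMg permM tpermV.
by case: tpermP => [->|->|].
Qed.

(** The initial tabloid has coefficient 1: a permutation preserving both columns and rows is the
    identity. *)
Lemma polytab1_neq0 : e1 != 0.
Proof.
apply/eqP => /rowP/(_ (enum_rank (tab_of lam 1%g))); rewrite polytab1E summxE mxE.
rewrite (bigD1 1%g) /=; last by apply/colstab1P => j; rewrite perm1.
rewrite odd_perm1 scale1r mxE !eqxx big1 ?addr0 => [/eqP|pi /andP[/colstab1P col_pi neq_pi]].
  by rewrite oner_eq0.
rewrite !mxE eqxx (inj_eq enum_rank_inj) /= (_ : _ == _ = false) ?mulr0 //.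
apply: contraNF neq_pi => /eqP eq_tab; apply/eqP/permP => j; rewrite perm1.
apply: (cell_inj lam_part); last exact: col_pi.
have := congr1 (fun f : tabloid n => val (f (pi j))) eq_tab.
by rewrite /= !ffunE invg1 perm1 permK !inordK ?(rowof_lt lam_part).
Qed.

Lemma polytab1_jm k :
  \sum_(i : 'I_n | (col i * n.+1 + row i < col k * n.+1 + row k)%N)
     e1 *m perm_mod_mx C (tperm i k) = ((col k)%:R - (row k)%:R) *: e1.
Proof.
have left c : (c <= col k)%N ->
    \sum_(i : 'I_n | (col i < c)%N) e1 *m perm_mod_mx C (tperm i k) = c%:R *: e1.
  elim: c => [|c IH] le_ck; first by rewrite big_pred0 ?scale0r.
  rewrite (bigID (fun i : 'I_n => col i == c)) /= -[c.+1]add1n natrD scalerDl scale1r.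
  rewrite -IH ?(ltnW le_ck) // -[X in _ = X + _](polytab1_garnir le_ck).
  by congr (_ + _); apply: eq_bigl => i; lia.
(* Rows are smaller than [n.+1], so the key compares columns first and rows second. *)
have keyE i : (col i * n.+1 + row i < col k * n.+1 + row k)%N =
    (col i < col k)%N || ((col i == col k) && (row i < row k)%N).
  have ri := rowof_lt lam_part i; have rk := rowof_lt lam_part k.
  have [lt_ik | lt_ki | ->] := ltngtP (col i) (col k); last by rewrite ltn_add2l.
    have := leq_mul lt_ik (leqnn n.+1); rewrite mulSn /=; lia.
  have := leq_mul lt_ki (leqnn n.+1); rewrite mulSn /=; lia.
rewrite (eq_bigl _ _ keyE) (bigID (fun i : 'I_n => col i < col k)%N) /=.
rewrite scalerBl -left //; congr (_ + _); first by apply: eq_bigl => i; lia.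
rewrite -[in RHS](card_above lam_part k) scaler_nat -sumr_const -sumrN.
apply: eq_big => [i|i /andP[/orP[->//|/andP[/eqP eq_ik lt_ik]] _]].
  by rewrite !inE; lia.
by apply: polytab1_col => //; apply: contraTneq lt_ik => ->; rewrite ltnn.
Qed.

Lemma prod_content (y : C) :
  \prod_(k < n) (y + ((col k)%:R - (row k)%:R)) = flam lam y.
Proof.
have [_ _ /eqP <-] := and3P lam_part.
rewrite (prod_cells lam (fun r c => y + (c%:R - r%:R))).
by apply: eq_bigr => i _; apply: eq_bigr => j _; rewrite -!natr1; ring.
Qed.

(** * Action of the cycle-counting central element on the Specht module *)

Definition cycle_mx (y : C) : 'M[C]_#|{: tabloid n}| :=
  \sum_s y ^+ #|porbits s| *: perm_mod_mx C s.

Lemma polytab_cycle_mx tau (y : C) :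
  polytab C lam tau *m cycle_mx y = flam lam y *: polytab C lam tau.
Proof.
have key_inj : injective (fun k : 'I_n => col k * n.+1 + row k)%N.
  move=> i k eq_ik; have lti := rowof_lt lam_part i; have ltk := rowof_lt lam_part k.
  apply: (cell_inj lam_part).
    by have := congr1 (modn^~ n.+1) eq_ik; rewrite /= !modnMDl !modn_small.
  by have := congr1 (divn^~ n.+1) eq_ik; rewrite /= !divnMDl // !divn_small // !addn0.
have := jucys_eigen y perm_mod_mx1 perm_mod_mxM key_inj polytab1_jm.
rewrite prod_content => eig.
rewrite -[tau in LHS]mul1g -[tau in RHS]mul1g -polytab_act scalemxAl -eig.
(* Centrality: conjugation by [tau] preserves the number of cycles, and
   [tau * s ^ tau = s * tau]. *)
rewrite [RHS]mulmx_suml /cycle_mx mulmx_sumr [LHS](reindex_inj (conjg_inj tau)) /=.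
apply: eq_bigr => s _; rewrite porbits_conj -scalemxAl -scalemxAr; congr (_ *: _).
by rewrite -!mulmxA -!perm_mod_mxM [(s * tau)%g]conjgC.
Qed.

Lemma specht_cycle_mx (y : C) :
  specht_mx C n lam *m cycle_mx y = flam lam y *: specht_mx C n lam.
Proof.
apply/row_matrixP => i; rewrite row_mul linearZ /= rowK.
exact: polytab_cycle_mx.
Qed.

Lemma specht_char1 : specht_char C lam (1%g : {perm 'I_n}) = (\rank (specht_mx C n lam))%:R.
Proof.
by rewrite /specht_char perm_mod_mx1 mulmx1 mulmxVp ?row_base_free // mxtrace1.
Qed.

Lemma specht_char1_neq0 : specht_char C lam (1%g : {perm 'I_n}) != 0.
Proof.
rewrite specht_char1 pnatr_eq0 mxrank_eq0; apply: contra polytab1_neq0 => /eqP S0.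
have := congr1 (matrix.row (enum_rank (1%g : {perm 'I_n}))) S0.
by rewrite rowK enum_rankK row0 => ->.
Qed.

Lemma sum_specht_char (y : C) :
  \sum_(s : {perm 'I_n}) specht_char C lam s * y ^+ #|porbits s| =
  flam lam y * specht_char C lam (1%g : {perm 'I_n}).
Proof.
rewrite specht_char1 /specht_char; set B := row_base _.
transitivity (\tr (B *m cycle_mx y *m pinvmx B)).
  rewrite /cycle_mx mulmx_sumr mulmx_suml raddf_sum; apply: eq_bigr => s _ /=.
  by rewrite -scalemxAr -scalemxAl mxtraceZ mulrC.
(* The basis consists of combinations of polytabloids, so it inherits their common eigenvalue. *)
have /submxP[D defB] : (B <= specht_mx C n lam)%MS by rewrite eq_row_base.
rewrite {1}defB -(mulmxA D) specht_cycle_mx -scalemxAr -defB -scalemxAl mxtraceZ.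
by rewrite mulmxVp ?row_base_free // mxtrace1.
Qed.

End SpechtModule.

(** * The wreath product *)

Section WreathGroup.
Context {n m : nat} {F : finFieldType} {H : {group {'GL_m[F]}}}.
Implicit Types (X Y Z : wr n m F) (s : {perm 'I_n}).

Definition wr_of_perm s : wr n m F := (s, [ffun=> 1%g]).

Lemma wr_eq X Y : X.1 = Y.1 -> (forall i, X.2 i = Y.2 i) -> X = Y.
Proof. by case: X Y => [s a] [t b] /= -> eq_ab; congr pair; apply/ffunP. Qed.

Lemma wmulA : associative (@wmul n m F).
Proof.
move=> X Y Z; apply: wr_eq => [|i]; first exact: mulgA.
by rewrite /= !ffunE /= mulgA permM.
Qed.

Lemma wmul1 X : wmul X (wr_of_perm 1%g) = X.
Proof. by apply: wr_eq => [|i]; rewrite /= ?mulg1 // !ffunE mulg1. Qed.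

Lemma w1mul X : wmul (wr_of_perm 1%g) X = X.
Proof. by apply: wr_eq => [|i]; rewrite /= ?mul1g // !ffunE perm1 mul1g. Qed.

Lemma wmulV X : wmul X (winv X) = wr_of_perm 1%g.
Proof. by apply: wr_eq => [|i]; rewrite /= ?mulgV // !ffunE permK mulgV. Qed.

Lemma wVmul X : wmul (winv X) X = wr_of_perm 1%g.
Proof. by apply: wr_eq => [|i]; rewrite /= ?mulVg // !ffunE mulVg. Qed.

Lemma in_wr_mul X Y : in_wr H X -> in_wr H Y -> in_wr H (wmul X Y).
Proof.
by move=> /forallP HX /forallP HY; apply/forallP => i; rewrite ffunE groupM.
Qed.

Lemma in_wr_inv X : in_wr H X -> in_wr H (winv X).
Proof. by move=> /forallP HX; apply/forallP => i; rewrite ffunE groupV. Qed.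

Lemma in_wr_perm s : in_wr H (wr_of_perm s).
Proof. by apply/forallP => i; rewrite ffunE group1. Qed.

Lemma in_SigmaP X : reflect (X = wr_of_perm X.1) (in_Sigma X).
Proof.
apply: (iffP forallP) => [X1 | -> i]; last by rewrite ffunE.
by apply: wr_eq => // i; rewrite ffunE; apply/eqP.
Qed.

(** Conjugation by [Y] is a bijection of the wreath product over [H], with inverse conjugation by
    [winv Y]; the elements sent into the symmetric group are the conjugates of its members. *)
Lemma sum_conj_Sigma (V : nmodType) (f : wr n m F -> V) Y : in_wr H Y ->
  \sum_(X | in_wr H X && in_Sigma (wmul (wmul Y X) (winv Y))) f X =
  \sum_s f (wmul (winv Y) (wmul (wr_of_perm s) Y)).
Proof.
move=> HY.
have conjK X : wmul (winv Y) (wmul (wmul (wmul Y X) (winv Y)) Y) = X.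
  by rewrite -!wmulA wVmul wmul1 wmulA wVmul w1mul.
have conjVK X : wmul (wmul Y (wmul (winv Y) (wmul X Y))) (winv Y) = X.
  by rewrite !wmulA wmulV w1mul -wmulA wmulV wmul1.
rewrite (reindex_onto (fun s => wmul (winv Y) (wmul (wr_of_perm s) Y))
  (fun X => (wmul (wmul Y X) (winv Y)).1)) /=.
  apply: eq_bigl => s; rewrite conjVK.
  rewrite !in_wr_mul ?in_wr_inv ?in_wr_perm // (introT (in_SigmaP _)) //=.
  by rewrite mulKVg mulgK eqxx.
by move=> X /andP[_ /in_SigmaP eqX]; rewrite -[RHS]conjK [in RHS]eqX.
Qed.

(** Along a cycle the product telescopes to the identity, from whichever point it starts. Its trace
    is the matrix size, which is [m.-1.+1] in the type ['GL_m[F]]. *)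
Lemma Lambda_boundary (C : numClosedFieldType) p d X (g : 'I_n -> {'GL_m[F]}) :
  (forall i, X.2 i = ((g i)^-1 * g (X.1 i))%g) ->
  Lambda C p d X = echar C p d (m.-1.+1%:R : F) ^+ #|porbits X.1|.
Proof.
move=> X2.
have prodX x0 a : \prod_(k < a) GLval (X.2 ((X.1 ^+ k)%g x0)) =
    GLval ((g x0)^-1 * g ((X.1 ^+ a)%g x0))%g.
  elim: a => [|a IH]; first by rewrite big_ord0 perm1 mulVg.
  by rewrite big_ord_recr /= IH X2 -GL_ME expgSr permM mulgA mulgK.
rewrite /Lambda -prodr_const; apply: eq_bigr => _ /imsetP[x1 _ ->].
case: pickP => [x0 x0P | /(_ x1)]; last by rewrite porbit_id.
rewrite /= prodX; move: x0P; rewrite -eq_porbit_mem => /eqP <-.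
by rewrite permX iter_porbit mulVg mxtrace1.
Qed.

End WreathGroup.

(** * The additive character on the prime field, and the evaluation of [W] *)

Lemma eq_natr_pchar (R : nzRingType) p a b : p \in [pchar R] ->
  (a%:R == b%:R :> R) = (a == b %[mod p])%N.
Proof.
move=> pR; wlog le_ba : a b / (b <= a)%N.
  by move=> IH; have [/IH // | /ltnW /IH] := leqP b a; rewrite eq_sym => ->; rewrite eq_sym.
by rewrite eqn_mod_dvd // (dvdn_pcharf pR) natrB // subr_eq0.
Qed.

(** Frobenius fixes the prime field, so the field trace there is multiplication by [d]; exponents of
    [zetap] matter only modulo [p]. *)
Lemma echar_nat (C : numClosedFieldType) p d (F : finFieldType) a :
  prime p -> #|F| = (p ^ d)%N -> echar C p d (a%:R : F) = zetap C p ^+ (a * d).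
Proof.
move=> p_pr cardF; have pF := card_finPcharP cardF p_pr.
have zeta_p : zetap C p ^+ p = 1.
  by rewrite /zetap exprAC rootCK ?prime_gt0 // sqrrN expr1n.
have tr_a : trFp p d (a%:R : F) = (a * d)%:R.
  rewrite /trFp (eq_bigr (fun=> a%:R)) => [|i _]; last first.
    by elim: (val i) => [|e IH]; rewrite ?expr1 // expnSr exprM IH -(pFrobenius_autE pF) rmorph_nat.
  by rewrite sumr_const card_ord natrM mulr_natr.
rewrite /echar /trexp tr_a -(expr_mod _ zeta_p) -[in RHS](expr_mod _ zeta_p).
(* The residue of [a * d] is a witness, so the default exponent 0 in [trexp] does not occur. *)
case: pickP => [k | /(_ (Ordinal (ltn_pmod (a * d) (prime_gt0 p_pr))))] /=.
  by rewrite (eq_natr_pchar _ _ pF) => /eqP->.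
by rewrite (eq_natr_pchar _ _ pF) modn_mod eqxx.
Qed.

Theorem theorem7p3 (C : numClosedFieldType) (p d : nat) (F : finFieldType)
    (m : nat) (H : {group {'GL_m[F]}}) (n : nat) (x : C) (lam : seq nat) :
  prime p -> #|F| = (p ^ d)%N -> (0 < m)%N -> (0 < n)%N -> is_partition n lam ->
  W_wr (n := n) p d x H (ind_char H (specht_char C lam)) =
  flam lam (x * zetap C p ^+ (m * d)).
Proof.
move=> p_pr cardF m_gt0 _ lam_part.
set chi := specht_char C lam; set y := x * _.
(* The index of the symmetric group in the wreath product: it scales both the degree of the induced
   character and the weighted sum, and cancels. *)
set c : C := (n`!%:R)^-1 * #|[set Y : wr n m F | in_wr H Y]|%:R.
have chi1_neq0 : chi 1%g != 0 := specht_char1_neq0 lam_part.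
have c_neq0 : c != 0.
  rewrite mulf_neq0 ?invr_eq0 ?pnatr_eq0 -?lt0n ?fact_gt0 //.
  by apply/card_gt0P; exists (wr_of_perm 1%g); rewrite inE in_wr_perm.
have ind1 : ind_char H chi (1%g, [ffun=> 1%g]) = c * chi 1%g.
  rewrite /ind_char -mulrA; congr (_ * _).
  rewrite -sum1_card natr_sum mulr_suml; apply: eq_big => [Y|Y _]; first by rewrite inE.
  by rewrite -/(wr_of_perm 1%g) wmul1 wmulV ifT ?mul1r //; apply/in_SigmaP.
rewrite /W_wr ind1.
suff -> : \sum_(X : wr n m F | in_wr H X) ind_char H chi X * psi x X.1 * Lambda C p d X =
    c * (flam lam y * chi 1%g).
  by rewrite [c * (_ * _)]mulrCA [LHS]mulrC mulfK // mulf_neq0.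
rewrite -(sum_specht_char lam_part) -/chi.
pose f (Z X : wr n m F) := if in_Sigma Z then chi Z.1 * psi x X.1 * Lambda C p d X else 0.
transitivity ((n`!%:R)^-1 * \sum_(Y : wr n m F | in_wr H Y) \sum_(X : wr n m F | in_wr H X)
    f (wmul (wmul Y X) (winv Y)) X).
  rewrite exchange_big mulr_sumr; apply: eq_bigr => X _.
  rewrite /ind_char -!mulrA; congr (_ * _); rewrite !mulr_suml; apply: eq_bigr => Y _.
  by rewrite /f /=; case: ifP; rewrite ?mul0r ?mulrA.
(* Every [Y] contributes the same sum over the symmetric group, so the cardinality in [c] is spread
   out as a sum of ones over [Y]. *)
rewrite -mulrA; congr (_ * _); rewrite -sum1_card natr_sum mulr_suml.
apply: eq_big => [Y|Y HY]; first by rewrite inE.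
rewrite mul1r /f -big_mkcondr /= sum_conj_Sigma //.
apply: eq_bigr => s _.
set X := wmul _ _; have X1 : X.1 = (s ^ Y.1)%g by [].
(* The conjugate of a pure permutation has coboundary coordinates, with [g i] being [Y.2] at the
   preimage of [i] under [Y.1]. *)
have X2 i : X.2 i = ((Y.2 ((Y.1^-1)%g i))^-1 * Y.2 ((Y.1^-1)%g (X.1 i)))%g.
  by rewrite X1 conjgE !permM permK !ffunE mul1g.
rewrite (Lambda_boundary C p d X2) echar_nat // prednK // X1.
rewrite -conjgC mulgK.
by rewrite /psi porbits_conj -mulrA -exprMn.
Qed.
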